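(* Consider a multirate GARK scheme with $M\ge 1$ micro-steps, with coefficients $A^{\{\mathfrak f,\mathfrak f\}}\in\mathbb{R}^{s^{\{\mathfrak f\}}\times s^{\{\mathfrak f\}}}$, $A^{\{\mathfrak s,\mathfrak s\}}\in\mathbb{R}^{s^{\{\mathfrak s\}}\times s^{\{\mathfrak s\}}}$, $b^{\{\mathfrak f\}}\in\mathbb{R}^{s^{\{\mathfrak f\}}}$, $b^{\{\mathfrak s\}}\in\mathbb{R}^{s^{\{\mathfrak s\}}}$, $A^{\{\mathfrak f,\mathfrak s,\lambda\}}\in\mathbb{R}^{s^{\{\mathfrak f\}}\times s^{\{\mathfrak s\}}}$, $A^{\{\mathfrak s,\mathfrak f,\lambda\}}\in\mathbb{R}^{s^{\{\mathfrak s\}}\times s^{\{\mathfrak f\}}}$ ($\lambda=1,\dots,M$), and suppose that the fast weights are positive: $b^{\{\mathfrak f\}}_i>0$ for $i=1,\dots,s^{\{\mathfrak f\}}$. Then the scheme is stability-decoupled if and only if $$A^{\{\mathfrak f,\mathfrak s,\lambda\}} = \left(B^{\{\mathfrak f\}}\right)^{-1}\left( b^{\{\mathfrak f\}}\, (b^{\{\mathfrak s\}})^T - (A^{\{\mathfrak s,\mathfrak f,\lambda\}})^T B^{\{\mathfrak s\}}\right),\qquad \lambda=1,\dots,M,$$ where $B^{\{\mathfrak f\}}=\mathrm{diag}(b^{\{\mathfrak f\}})$ and $B^{\{\mathfrak s\}}=\mathrm{diag}(b^{\{\mathfrak s\}})$.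
   Context: Multirate GARK method. For an ODE $y'=f^{\{\mathfrak s\}}(y)+f^{\{\mathfrak f\}}(y)$ with a slow part $\mathfrak s$ and a fast part $\mathfrak f$, one macro-step of size $H$ with $M$ equal micro-steps of size $h=H/M$ reads $$Y_i^{\{\mathfrak s\}} = y_n + H\sum_{j=1}^{s^{\{\mathfrak s\}}} a_{i,j}^{\{\mathfrak s,\mathfrak s\}} f^{\{\mathfrak s\}}(Y_j^{\{\mathfrak s\}}) + h\sum_{\lambda=1}^M\sum_{j=1}^{s^{\{\mathfrak f\}}} a_{i,j}^{\{\mathfrak s,\mathfrak f,\lambda\}} f^{\{\mathfrak f\}}(Y_j^{\{\mathfrak f,\lambda\}}),$$ $$Y_i^{\{\mathfrak f,\lambda\}} = y_n + h\sum_{l=1}^{\lambda-1}\sum_{j=1}^{s^{\{\mathfrak f\}}} b_j^{\{\mathfrak f\}} f^{\{\mathfrak f\}}(Y_j^{\{\mathfrak f,l\}}) + H\sum_{j=1}^{s^{\{\mathfrak s\}}} a_{i,j}^{\{\mathfrak f,\mathfrak s,\lambda\}} f^{\{\mathfrak s\}}(Y_j^{\{\mathfrak s\}}) + h\sum_{j=1}^{s^{\{\mathfrak f\}}} a_{i,j}^{\{\mathfrak f,\mathfrak f\}} f^{\{\mathfrak f\}}(Y_j^{\{\mathfrak f,\lambda\}}),\quad \lambda=1,\dots,M,$$ $$y_{n+1} = y_n + h\sum_{\lambda=1}^M\sum_{i=1}^{s^{\{\mathfrak f\}}} b_i^{\{\mathfrak f\}} f^{\{\mathfrak f\}}(Y_i^{\{\mathfrak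 f,\lambda\}}) + H\sum_{i=1}^{s^{\{\mathfrak s\}}} b_i^{\{\mathfrak s\}} f^{\{\mathfrak s\}}(Y_i^{\{\mathfrak s\}}).$$ The base schemes are the Runge-Kutta methods $(A^{\{\mathfrak f,\mathfrak f\}},b^{\{\mathfrak f\}})$ (fast) and $(A^{\{\mathfrak s,\mathfrak s\}},b^{\{\mathfrak s\}})$ (slow). Block tableau (bold symbols). Let $\mathbf 1$ be the vector of ones. - $\mathbf A^{\{\mathfrak f,\mathfrak f\}}$ is the $M\times M$ block lower triangular matrix with diagonal blocks $\frac1M A^{\{\mathfrak f,\mathfrak f\}}$, strictly lower blocks $\frac1M\mathbf 1 (b^{\{\mathfrak f\}})^T$, and zero blocks above the diagonal. - $\mathbf A^{\{\mathfrak f,\mathfrak s\}}$ is the block column with blocks $A^{\{\mathfrak f,\mathfrak s,1\}},\dots,A^{\{\mathfrak f,\mathfrak s,M\}}$. - $\mathbf A^{\{\mathfrak s,\mathfrak f\}}=\left[\frac1M A^{\{\mathfrak s,\mathfrak f,1\}},\dots,\frac1M A^{\{\mathfrak s,\mathfrak f,M\}}\right]$ and $\mathbf A^{\{\mathfrak s,\mathfrak s\}}=A^{\{\mathfrak s,\mathfrak s\}}$. - $(\mathbf b^{\{\mathfrak f\}})^T=\left[\frac1M (b^{\{\mathfrak f\}})^T,\dots,\frac1M (b^{\{\mathfrak f\}})^T\right]$ ($M$ blocks) and $\mathbf b^{\{\mathfrak s\}}=b^{\{\mathfrak s\}}$. For $m,\ell\in\{\mathfrak f,\mathfrak s\}$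 put $\mathbf B^{\{m\}}=\mathrm{diag}(\mathbf b^{\{m\}})$ and $$\mathbf P^{\{m,\ell\}} = (\mathbf A^{\{m,\ell\}})^T\mathbf B^{\{m\}} + \mathbf B^{\{\ell\}}\mathbf A^{\{\ell,m\}} - \mathbf b^{\{\ell\}}(\mathbf b^{\{m\}})^T .$$ The scheme is called stability-decoupled if $\mathbf P^{\{\mathfrak f,\mathfrak s\}}=\mathbf 0$ (and therefore also $\mathbf P^{\{\mathfrak s,\mathfrak f\}}=(\mathbf P^{\{\mathfrak f,\mathfrak s\}})^T=\mathbf 0$). *)

(* Defs.v *)
From HB Require Import structures.
From mathcomp Require Import all_boot all_order all_algebra.
From mathcomp Require Import reals.

Set Implicit Arguments.
Unset Strict Implicit.
Unset Printing Implicit Defensive.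

Import Order.TTheory GRing.Theory Num.Theory.
Local Open Scope ring_scope.

(* Coefficients of a multirate GARK scheme with M micro-steps.  Weight vectors
   are columns; the micro-step index lambda = 1..M is shifted to 0..M-1. *)
Record mrgark (R : realType) (M sf ss : nat) := MrGark {
  A_ff : 'M[R]_sf;
  A_ss : 'M[R]_ss;
  A_fs : 'I_M -> 'M[R]_(sf, ss);
  A_sf : 'I_M -> 'M[R]_(ss, sf);
  b_f : 'cV[R]_sf;
  b_s : 'cV[R]_ss
}.

Inductive part := fast | slow.

Definition diag_col (R : realType) (n : nat) (b : 'cV[R]_n) : 'M[R]_n :=
  diag_mx b^T.

Section BlockTableau.

Variables (R : realType) (M sf ss : nat) (G : mrgark R M sf ss).

Definition bsize (m : part) : nat :=
  match m with
  | fast => \sum_(l < M) sf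
  | slow => ss
  end.

Definition bA_ff : 'M[R]_(bsize fast) :=
  \mxblock_(i < M, j < M)
    (if i == j then M%:R^-1 *: A_ff G
     else if (j < i)%N then M%:R^-1 *: (const_mx 1 *m (b_f G)^T)
     else 0).

Definition bA_fs : 'M[R]_(bsize fast, bsize slow) := \mxcol_(l < M) A_fs G l.

Definition bA_sf : 'M[R]_(bsize slow, bsize fast) :=
  \mxrow_(l < M) (M%:R^-1 *: A_sf G l).

Definition bA (m l : part) : 'M[R]_(bsize m, bsize l) :=
  match m, l with
  | fast, fast => bA_ff
  | fast, slow => bA_fs
  | slow, fast => bA_sf
  | slow, slow => A_ss G
  end.

Definition bb (m : part) : 'cV[R]_(bsize m) :=
  match m with
  | fast => \mxcol_(l < M) (M%:R^-1 *: b_f G)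
  | slow => b_s G
  end.

Definition bB (m : part) : 'M[R]_(bsize m) := diag_col (bb m).

Definition bP (m l : part) : 'M[R]_(bsize l, bsize m) :=
  (bA m l)^T *m bB m + bB l *m bA l m - bb l *m (bb m)^T.

Definition stability_decoupled : Prop := bP fast slow = 0.

End BlockTableau.

(* Main.v *)
Require Import Defs.
From HB Require Import structures.
From mathcomp Require Import all_boot all_order all_algebra.
From mathcomp Require Import reals.

Set Implicit Arguments.
Unset Strict Implicit.
Unset Printing Implicit Defensive.

Import Order.TTheory GRing.Theory Num.Theory.
Local Open Scope ring_scope.

(** The matrix [bP G fast slow] is a block row indexed by the micro-steps, and
    its blocks do not interact: the only product across the fast stages is
    with the diagonal matrix [bB G fast].  Each of the three terms of a block
    contains exactly one factor [1 / M], brought by the fast weights in the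
    first and third terms and by the slow-to-fast coefficients in the second.
    Hence the [l]-th block is [1 / M] times the transpose of
      [B_f *m A_fs l + (A_sf l)^T *m B_s - b_f *m b_s^T]
    (lemma [bP_fast_slow]).  As [1 / M] is nonzero, decoupling means that each
    of these [M] defects vanishes, and positivity of the fast weights makes
    [B_f] invertible, so each such equation can be solved for [A_fs l]. *)

Lemma diag_col_unitmx (R : realType) (n : nat) (b : 'cV[R]_n) :
  (forall i, 0 < b i 0) -> diag_col b \in unitmx.
Proof.
move=> b_gt0; rewrite unitmxE unitfE det_diag prodf_seq_neq0.
by apply/allP => i _; rewrite mxE gt_eqF.
Qed.

(** Failure of the coupling condition at one micro-step; it is kept free of
    [1 / M] because the scaling is common to all of its terms. *)
Definition coupling_defect (R : realType) (M sf ss : nat)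
    (G : mrgark R M sf ss) (l : 'I_M) : 'M[R]_(sf, ss) :=
  diag_col (b_f G) *m A_fs G l + (A_sf G l)^T *m diag_col (b_s G)
  - b_f G *m (b_s G)^T.

Lemma bP_fast_slow (R : realType) (M sf ss : nat) (G : mrgark R M sf ss) :
  bP G fast slow = \mxrow_(l < M) (M%:R^-1 *: (coupling_defect G l)^T).
Proof.
rewrite /bP /bB /= /bA_fs /bA_sf /diag_col !tr_mxcol diag_mxrow.
rewrite mul_mxrow_mxdiag !mul_mxrow -mxrowD -mxrowB.
apply: eq_mxrow => l.
rewrite !linearZ /= -!scalerDr; congr (_ *: _).
rewrite /coupling_defect /diag_col linearB linearD /= !trmx_mul !trmxK.
by rewrite !tr_diag_mx.
Qed.

Lemma stability_decoupledP (R : realType) (M sf ss : nat)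
    (G : mrgark R M sf ss) :
  (1 <= M)%N ->
  stability_decoupled G <-> forall l, coupling_defect G l = 0.
Proof.
move=> M_gt0; rewrite /stability_decoupled bP_fast_slow.
have Mn0 : M%:R^-1 != 0 :> R by rewrite invr_eq0 pnatr_eq0 -lt0n.
split=> [P0 l | defect0].
  have /eqP : M%:R^-1 *: (coupling_defect G l)^T = 0.
    by rewrite -[LHS](mxrowK (fun l => M%:R^-1 *: (coupling_defect G l)^T))
               P0 submxrow0.
  by rewrite scaler_eq0 (negPf Mn0) trmx_eq0 => /eqP.
by rewrite -[RHS]mxrow0; apply: eq_mxrow => l; rewrite defect0 trmx0 scaler0.
Qed.

Theorem theorem2p2 (R : realType) (M sf ss : nat) (G : mrgark R M sf ss)
    (hM : (1 <= M)%N) (hbf : forall i : 'I_sf, 0 < b_f G i 0) :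
  stability_decoupled G <->
  forall l : 'I_M,
    A_fs G l = invmx (diag_col (b_f G)) *m
      (b_f G *m (b_s G)^T - (A_sf G l)^T *m diag_col (b_s G)).
Proof.
have uB := diag_col_unitmx hbf.
apply: (iff_trans (stability_decoupledP G hM)).
split=> coupling l; move: (coupling l); rewrite /coupling_defect.
  by move=> /eqP; rewrite subr_eq0 => /eqP <-; rewrite addrK mulKmx.
by move=> ->; rewrite mulKVmx // subrK subrr.
Qed.
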